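(* Let $\Bbbk$ be an infinite field and $A=\Bbbk[x_1,\ldots,x_n]$, with $\mathbb{N}^2$-grading given by $\deg x_1=(1,0)$ and $\deg x_i=(0,1)$ for $2\le i\le n$. Let $\mathfrak{a}\subseteq A$ be a multigraded ideal (i.e., homogeneous for this $\mathbb{N}^2$-grading) with $\mathfrak{a}_1=0$, let $R=A/\mathfrak{a}$, and let $L=(l_{i,j}: 1\le i\le n,\ j\in\mathbb{N})$ be a distraction matrix such that $l_{i,j}=x_i$ for all $2\le i\le n$ and all $j\in\mathbb{N}$. If $\mathcal{H}_R$ admits an embedding, then $\mathcal{H}_{A/D_L(\mathfrak{a})}$ admits an embedding.
   Context: $\mathbb{N}$ is the set of non-negative integers. For a standard graded $\Bbbk$-algebra $R=\bigoplus_{d\ge0}R_d$ ($R_0=\Bbbk$, $R=\Bbbk[R_1]$, $\dim_\Bbbk R_1<\infty$), $\mathcal{I}_R$ is the set of homogeneous ideals of $R$ (in the standard grading), partially ordered by inclusion; $H_I(\mathfrak{z})=\sum_{d\in\mathbb{N}}(\dim_\Bbbk I_d)\mathfrak{z}^d\in\mathbb{Z}[[\mathfrak{z}]]$ is the Hilbert series of $I\in\mathcal{I}_R$; $\mathcal{H}_R=\{H_J: J\in\mathcal{I}_R\}$, partially ordered coefficientwise. $\mathcal{H}_R$ admits an embedding (into $\mathcal{I}_R$) if there is an order-preserving injective map $\epsilon:\mathcal{H}_R\to\mathcal{I}_R$ with $H_{\epsilon(H)}=H$ for all $H\in\mathcal{H}_R$. Subscript $1$ in $\mathfrak a_1$ refers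 to the standard grading of $A$. A distraction matrix is an infinite matrix $L=(l_{i,j}:1\le i\le n,\ j\in\mathbb{N})$ such that: (i) $l_{i,j}\in A_1$ (a linear form) for all $i,j$; (ii) for all $j_1,\ldots,j_n\in\mathbb{N}$, $\{l_{1,j_1},\ldots,l_{n,j_n}\}$ spans $A_1$ as a $\Bbbk$-vector space; (iii) there exists $N\in\mathbb{N}$ such that $l_{i,j}=l_{i,N}$ for all $i$ and all $j\ge N$. The distraction associated to $L$ is the $\Bbbk$-linear map $D_L:A\to A$ with $\prod_{i=1}^n x_i^{a_i}\mapsto\prod_{i=1}^n\prod_{j=1}^{a_i}l_{i,j}$. For $L$ and $\mathfrak a$ as in the claim, $D_L(\mathfrak{a})$ is a homogeneous ideal of $A$. *)

(* Defs.v *)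
From HB Require Import structures.
From mathcomp Require Import all_boot all_order all_algebra ring_quotient.
From mathcomp Require Import boolp classical_sets functions cardinality.
From mathcomp Require Import ssrcomplements mpoly.

Set Implicit Arguments.
Unset Strict Implicit.
Unset Printing Implicit Defensive.

Import Order.TTheory GRing.Theory Num.Theory.
Local Open Scope ring_scope.
Local Open Scope classical_set_scope.
Local Open Scope quotient_scope.

(* [ring_quotient] only makes the quotient by an ideal a commutative ring; for *)
(* an algebra over k, the induced k-action is added here, see [pi_quotZ].      *)
Section QuotientAlgebra.
Variables (k : fieldType) (A : comAlgType k) (I : idealr A).
Local Notation Q := {ideal_quot I}.

Definition quot_scale (c : k) (x : Q) : Q := \pi_Q (c%:A) * x.

Lemma quot_scaleA c d x : quot_scale c (quot_scale d x) = quot_scale (c * d) x.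
Proof.
by rewrite /quot_scale mulrA -[_ * \pi_Q _]rmorphM -scalerAl mul1r scalerA.
Qed.

Lemma quot_scale1 : left_id 1 quot_scale.
Proof. by move=> x; rewrite /quot_scale scale1r rmorph1 mul1r. Qed.

Lemma quot_scaleDr : right_distributive quot_scale +%R.
Proof. by move=> c x y; rewrite /quot_scale mulrDr. Qed.

Lemma quot_scaleDl x : {morph quot_scale^~ x : c d / c + d}.
Proof. by move=> c d; rewrite /quot_scale scalerDl rmorphD mulrDl. Qed.

HB.instance Definition _ := GRing.Zmodule_isLmodule.Build k (Quotient.quot I)
  quot_scaleA quot_scale1 quot_scaleDr quot_scaleDl.

Lemma quot_scaleAl (c : k) (x y : Q) : c *: (x * y) = c *: x * y.
Proof. exact: mulrA. Qed.

HB.instance Definition _ :=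
  GRing.Lmodule_isLalgebra.Build k (Quotient.quot I) quot_scaleAl.

Lemma quot_scaleAr (c : k) (x y : Q) : c *: (x * y) = x * (c *: y).
Proof. exact: mulrCA. Qed.

HB.instance Definition _ :=
  GRing.Lalgebra_isAlgebra.Build k (Quotient.quot I) quot_scaleAr.

Lemma pi_quotZ (c : k) (p : A) : \pi_Q (c *: p) = c *: \pi_Q p.
Proof. by rewrite -[p in LHS]mul1r scalerAl [LHS]rmorphM. Qed.

End QuotientAlgebra.

Section Dimension.
Variables (k : fieldType) (V : lmodType k).

Definition is_basis (W : set V) (d : nat) (b : 'I_d -> V) : Prop :=
  [/\ forall i, W (b i),
      forall c : 'I_d -> k, \sum_(i < d) c i *: b i = 0 -> forall i, c i = 0
    & forall v, W v -> exists c : 'I_d -> k, v = \sum_(i < d) c i *: b i].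

(* The default value 0 on subspaces of infinite dimension is never used: it is applied *)
(* to subspaces of the graded components of quotients of polynomial rings.     *)
Definition dimension (W : set V) : nat :=
  xget 0%N [set d | exists b : 'I_d -> V, is_basis W b].

End Dimension.

Section GradedAlgebra.
Variables (k : fieldType) (R : comAlgType k).

Definition is_ideal (I : set R) : Prop :=
  [/\ I 0, forall f g, I f -> I g -> I (f + g)
    & forall r f, I f -> I (r * f)].

(* A grading is given by its family G of components, over any index type D;   *)
(* I is homogeneous when it is the sum of its components I `&` G d.           *)
Definition homogeneous (D : Type) (G : D -> set R) (I : set R) : Prop :=
  forall f, I f -> exists (s : seq D) (g : D -> R),
    (forall d, (I `&` G d) (g d)) /\ f = \sum_(d <- s) g d.

Variable G : nat -> set R.

Definition homogeneous_ideals : set (set R) :=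
  [set I | is_ideal I /\ homogeneous G I].

(* A series in Z[[z]] is identified with its sequence of coefficients. *)
Definition hilbert_series (I : set R) : nat -> int :=
  fun d => (dimension (I `&` G d))%:Z.

Definition hilbert_set : set (nat -> int) :=
  [set hilbert_series J | J in homogeneous_ideals].

Definition le_series (H H' : nat -> int) : Prop := forall d, H d <= H' d.

Definition admits_embedding : Prop :=
  exists eps : (nat -> int) -> set R,
    [/\ set_fun hilbert_set homogeneous_ideals eps,
        forall H H', hilbert_set H -> hilbert_set H' ->
          eps H = eps H' -> H = H',
        forall H H', hilbert_set H -> hilbert_set H' ->
          le_series H H' -> eps H `<=` eps H'
      & forall H, hilbert_set H -> hilbert_series (eps H) = H].

End GradedAlgebra.

(* The polynomial ring in n.+1 variables; the first variable is 'X_ord0. *)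
Section PolynomialRing.
Variables (k : fieldType) (n : nat).
Local Notation A := {mpoly k[n.+1]}.

Definition std_grading (d : nat) : set A := [set p | p \is d.-homog].

Definition quot_grading (a : idealr A) (d : nat) : set {ideal_quot a} :=
  \pi_{ideal_quot a} @` std_grading d.

Definition bidegree (m : 'X_{1..n.+1}) : nat * nat :=
  (m ord0, \sum_(i | i != ord0) m i)%N.

Definition bigrading (uv : nat * nat) : set A :=
  [set p | forall m, m \in msupp p -> bidegree m = uv].

Definition distraction_matrix (L : 'I_n.+1 -> nat -> A) : Prop :=
  [/\ forall i j, std_grading 1 (L i j),
      forall (j : 'I_n.+1 -> nat) (l : A), std_grading 1 l ->
        exists c : 'I_n.+1 -> k, l = \sum_i c i *: L i (j i)
    & exists N, forall i j, (N <= j)%N -> L i j = L i N].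

Definition distraction (L : 'I_n.+1 -> nat -> A) (p : A) : A :=
  \sum_(m <- msupp p) p@_m *: \prod_i \prod_(1 <= j < (m i).+1) L i j.

Definition distraction_image (L : 'I_n.+1 -> nat -> A) (a : idealr A) : A -> bool :=
  fun p => `[< (distraction L @` [set` a]) p >].

Section DistractionIdeal.
Variables (L : 'I_n.+1 -> nat -> A) (a : idealr A).
Hypothesis L_distr : distraction_matrix L.
Hypothesis L_var : forall i : 'I_n.+1, i != ord0 -> forall j, L i j = 'X_i.
Hypothesis a_bigraded : homogeneous bigrading [set` a].

Let E (m : 'X_{1..n.+1}) : A := \prod_i \prod_(1 <= j < (m i).+1) L i j.

Lemma distractionwE p d : (msize p <= d)%N ->
  distraction L p = \sum_(m : 'X_{1..n.+1 < d}) p@_m *: E m.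
Proof.
move=> le_pd; rewrite /distraction (big_mksub 'X_{1..n.+1 < d}) //=; first last.
- by move=> x /msize_mdeg_lt /leq_trans; apply.
- exact: msupp_uniq.
by rewrite big_rmcond //= => i /memN_msupp_eq0 ->; rewrite scale0r.
Qed.

Lemma distraction_is_linear : linear (distraction L).
Proof.
move=> c p q; pose d := maxn (msize p) (maxn (msize q) (msize (c *: p + q))).
rewrite !(@distractionwE _ d) ?leq_max ?leqnn ?orbT // scaler_sumr -big_split.
by apply: eq_bigr => m _; rewrite mcoeffD mcoeffZ scalerDl scalerA.
Qed.

HB.instance Definition _ :=
  GRing.isLinear.Build k A A *:%R (distraction L) distraction_is_linear.

Lemma distractionX m : distraction L 'X_[m] = E m.
Proof. by rewrite /distraction msuppX big_seq1 mcoeffX eqxx scale1r. Qed.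

Lemma distractionXvar i m : E (U_(i) + m) = L i (m i).+1 * E m.
Proof.
rewrite /E (bigD1 i) //= [in RHS](bigD1 i) //= mulrA; congr (_ * _).
  by rewrite mnmDE mnm1E eqxx add1n big_nat_recr //= mulrC.
by apply: eq_bigr => j neq_ji; rewrite mnmDE mnm1E eq_sym (negPf neq_ji).
Qed.

Lemma distractionM_hom i q e : (forall m, m \in msupp q -> m i = e) ->
  distraction L ('X_i * q) = L i e.+1 * distraction L q.
Proof.
move=> hq; rewrite [in LHS](mpolyE q) mulr_sumr linear_sum mulr_sumr.
rewrite big_seq [RHS]big_seq; apply: eq_bigr => m m_q.
by rewrite -scalerAr linearZ /= -mpolyXD distractionX distractionXvar hq // scalerAr.
Qed.

Lemma distractionM_var i q : i != ord0 ->
  distraction L ('X_i * q) = 'X_i * distraction L q.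
Proof.
move=> i0; rewrite [in LHS](mpolyE q) mulr_sumr linear_sum mulr_sumr.
apply: eq_bigr => m _.
by rewrite -scalerAr linearZ /= -mpolyXD distractionX distractionXvar L_var // scalerAr.
Qed.

Lemma mem_distractionP p :
  reflect (exists2 q, q \in (a : pred A) & distraction L q = p)
          (distraction_image L a p).
Proof. exact: asboolP. Qed.

Lemma distraction_imageD p q : distraction_image L a p -> distraction_image L a q ->
  distraction_image L a (p + q).
Proof.
move=> /mem_distractionP[f fa <-] /mem_distractionP[g ga <-].
by apply/mem_distractionP; exists (f + g); rewrite ?linearD // rpredD.
Qed.

Lemma distraction_imageZ c p : distraction_image L a p ->
  distraction_image L a (c *: p).
Proof.
move=> /mem_distractionP[f fa <-]; apply/mem_distractionP.
by exists (c *: f); rewrite ?linearZ // -mul_mpolyC idealMr.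
Qed.

Lemma distraction_image0 : distraction_image L a 0.
Proof. by apply/mem_distractionP; exists 0; rewrite ?linear0 ?rpred0. Qed.

Lemma distraction_image_sum (T : eqType) (s : seq T) (F : T -> A) :
  (forall t, t \in s -> distraction_image L a (F t)) ->
  distraction_image L a (\sum_(t <- s) F t).
Proof.
move=> hF; rewrite big_seq; elim/big_ind: _ => //; first exact: distraction_image0.
exact: distraction_imageD.
Qed.

Lemma distraction_imageMvar i p : distraction_image L a p ->
  distraction_image L a ('X_i * p).
Proof.
move=> /mem_distractionP[f fa <-].
have [i0|i0] := eqVneq i ord0; last first.
  by apply/mem_distractionP; exists ('X_i * f); rewrite ?distractionM_var ?idealMr.
have [s [g [hg ->]]] := a_bigraded fa.
rewrite linear_sum mulr_sumr.
apply: distraction_image_sum => -[e v] _; have [ga gh] := hg (e, v).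
set q := g _ in ga gh *.
have hq m : m \in msupp q -> m ord0 = e by move=> /gh[].
have [_ /(_ (fun=> e.+1) 'X_i) span _] := L_distr.
have [|c Xc] := span; first by rewrite /std_grading /= dhomogX /= mdeg1.
rewrite Xc mulr_suml; apply: distraction_image_sum => j _.
rewrite -scalerAl; apply: distraction_imageZ; apply/mem_distractionP.
exists ('X_j * q); first exact: idealMr.
have [->|j0] := eqVneq j ord0; first exact: distractionM_hom.
by rewrite distractionM_var // L_var.
Qed.

Lemma distraction_imageM r p : distraction_image L a p ->
  distraction_image L a (r * p).
Proof.
move=> pa; rewrite (mpolyE r) mulr_suml; apply: distraction_image_sum => m _.
rewrite -scalerAl; apply: distraction_imageZ; rewrite mpolyXE_id.
elim/big_rec: _ => [|i x _ IH]; first by rewrite mul1r.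
rewrite -mulrA; elim: (m i) => [|e IHe]; first by rewrite mul1r.
by rewrite exprS -mulrA distraction_imageMvar.
Qed.

Lemma mnm_neq0 (m : 'X_{1..n.+1}) : m != 0%MM -> exists i, m i != 0%N.
Proof.
move=> m0; apply/existsP; rewrite -negb_forall; apply: contra m0 => /forallP m0.
by apply/eqP/mnmP => i; rewrite mnm0E (eqP (m0 i)).
Qed.

Lemma linear_form0 p : std_grading 1 p -> p.@[fun=> 0] = 0.
Proof.
move=> /dhomogP p1; rewrite mevalE big_seq big1 // => m /p1 /= m1.
have [|i mi0] := @mnm_neq0 m; first by rewrite -mdeg_eq0 m1.
by rewrite (bigD1 i) //= expr0n (negPf mi0) mul0r mulr0.
Qed.

Lemma distraction_image1 : ~~ distraction_image L a 1.
Proof.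
apply/negP => /mem_distractionP[f fa].
have [s [g [hg ->]]] := a_bigraded fa.
move=> /(congr1 (meval (fun=> 0))); rewrite meval1 (linear_sum (distraction L)) raddf_sum /=.
apply/eqP; rewrite big1 1?eq_sym ?oner_eq0 // => -[u v] _.
have [ga gh] := hg (u, v); set q := g _ in ga gh *.
rewrite /distraction raddf_sum big_seq big1 //= => m m_q.
rewrite mevalZ rmorph_prod /=.
have [m0|/mnm_neq0[i mi0]] := eqVneq m 0%MM; last first.
  have [hl _ _] := L_distr.
  rewrite (bigD1 i) //= rmorph_prod /= -(prednK (_ : 0 < m i)%N) ?lt0n //.
  by rewrite big_nat_recr //= linear_form0 // !(mulr0, mul0r).
have uv : bidegree 0%MM = (u, v) by rewrite -m0; apply: gh.
have q_cst m' : m' \in msupp q -> m' = 0%MM.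
  move=> /gh; rewrite -uv => -[]; rewrite mnm0E => e0 e1.
  apply/eqP; rewrite -mdeg_eq0 mdegE (bigD1 ord0) //= e0 e1.
  by rewrite big1 // => j _; rewrite mnm0E.
have q0 : q@_0 != 0 by rewrite -mcoeff_msupp -m0.
have qE : q = q@_0 *: 1.
  apply/mpolyP => m'; rewrite mcoeffZ mcoeff1.
  have [->|m'0] := eqVneq m' 0%MM; first by rewrite mulr1.
  by rewrite mulr0; apply: memN_msupp_eq0; apply: contra m'0 => /q_cst ->.
have : (q@_0)^-1%:MP * q \in (a : pred A) by rewrite idealMr.
by rewrite [X in _ * X]qE mul_mpolyC scalerA mulVf // scale1r idealr1.
Qed.

Lemma distraction_idealr_closed : idealr_closed (distraction_image L a).
Proof.
split; [exact: distraction_image0|exact: distraction_image1|move=> r p q pa qa].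
exact/distraction_imageD/qa/distraction_imageM.
Qed.

Definition distraction_ideal : idealr A := HB.pack (distraction_image L a)
  (isIdealr.Build A (distraction_image L a) distraction_idealr_closed).

End DistractionIdeal.
End PolynomialRing.

Arguments std_grading {k n} d.
Arguments bigrading {k n} uv.
Arguments quot_grading {k n} a d.
Arguments distraction_ideal {k n L a}.

(* Main.v *)
Require Import Defs.
From HB Require Import structures.
From mathcomp Require Import all_boot all_order all_algebra ring_quotient.
From mathcomp Require Import boolp classical_sets functions cardinality.
From mathcomp Require Import ssrcomplements mpoly.

Set Implicit Arguments.
Unset Strict Implicit.
Unset Printing Implicit Defensive.

Import Order.TTheory GRing.Theory Num.Theory.
Local Open Scope ring_scope.
Local Open Scope classical_set_scope.

(** Let A = k[x_0, ..., x_n] and let D be the distraction map.  Write in(J) for the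
ideal spanned by the x_0-leading forms of the elements of a homogeneous ideal J:
each element is replaced by its component of highest degree in x_0.  Three facts
carry the proof.

- The passage J |-> in(J) is monotone and preserves the Hilbert function, since
  J and in(J) have the same successive quotients for the filtration of each A_d
  by the degree in x_0 ([dimension_initial]).  Moreover in(J) is bihomogeneous,
  and an ideal I that is already bihomogeneous satisfies I <= in(I)
  ([initial_xgraded], [sub_initial]).

- The map D sends bihomogeneous ideals to homogeneous ideals with the same
  Hilbert function ([is_ideal_distraction], [dimension_distraction]): it is
  injective and respects the standard grading.

- The operation in undoes D.  The spanning axiom forces the form l_{0,j} to be a
  nonzero multiple of x_0 plus a combination of the other variables, and the
  other rows of L are the variables themselves; so the x_0-leading form of D(m)
  is a nonzero multiple of the monomial m, by a scalar that depends only on the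
  x_0-degree of m ([xsize_distractionX]).  Hence D(a) <= J implies a <= in(J)
  ([sub_initial_distraction]).

Ideals of A/a are the ideals of A that contain a, and the Hilbert functions
upstairs and downstairs differ by that of a, which is also that of D(a).  So
J |-> in(J) shows that every Hilbert function of A/D(a) is one of A/a
([hilbert_set_sub]).  In the other direction, I |-> D(in(I)) is a monotone map
from ideals containing a to ideals containing D(a), as a <= in(a) <= in(I), and it
preserves Hilbert functions ([transferP]).  Composing an embedding for A/a with
this map gives an embedding for A/D(a); it is injective because its values still
have the prescribed Hilbert functions. *)

(** * Dimension of finitely spanned subspaces *)

Section Subspaces.
Variables (k : fieldType) (V : lmodType k).
Implicit Types W : set V.

Definition subspace W : Prop :=
  W 0 /\ forall (c : k) x y, W x -> W y -> W (c *: x + y).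

Definition spanned W : Prop := exists (N : nat) (e : 'I_N -> V),
  forall v, W v -> exists c : 'I_N -> k, v = \sum_i c i *: e i.

Definition independent (d : nat) (b : 'I_d -> V) : Prop :=
  forall c : 'I_d -> k, \sum_i c i *: b i = 0 -> forall i, c i = 0.

Lemma subspace_lincomb W d (b : 'I_d -> V) (c : 'I_d -> k) :
  subspace W -> (forall i, W (b i)) -> W (\sum_i c i *: b i).
Proof.
move=> [W0 WD] Wb; elim/big_rec: _ => // i x _ Wx.
exact: WD.
Qed.

Lemma subspaceI W W' : subspace W -> subspace W' -> subspace (W `&` W').
Proof.
by move=> [W0 WD] [W0' WD']; split=> // c x y [Wx Wx'] [Wy Wy']; split; auto.
Qed.

Lemma spanned_sub W W' : W `<=` W' -> spanned W' -> spanned W.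
Proof. by move=> WW' [N [e He]]; exists N, e => v /WW'/He. Qed.

(** If d > N, the matrix of coordinates of the [b i] on [e] has more rows than its
rank, so some nonzero combination of its rows vanishes. *)
Lemma independent_leq N (e : 'I_N -> V) d (b : 'I_d -> V) :
    (forall i, exists c : 'I_N -> k, b i = \sum_j c j *: e j) ->
  independent b -> (d <= N)%N.
Proof.
move=> /boolp.choice[M bE] b_ind; rewrite leqNgt; apply/negP => ltNd.
pose A : 'M[k]_(d, N) := \matrix_(i, j) M i j.
have /rowV0Pn[x /sub_kermxP xA x0] : kermx A != 0.
  by rewrite -mxrank_eq0 mxrank_ker -lt0n subn_gt0 (leq_ltn_trans (rank_leq_col A)).
have : \sum_i x 0 i *: b i = 0.
  under eq_bigr => i _ do rewrite bE scaler_sumr.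
  rewrite exchange_big /= big1 // => j _.
  have := congr1 (fun B : 'rV_N => B 0 j) xA; rewrite !mxE => xAj.
  rewrite -[RHS](scale0r (e j)) -[in RHS]xAj scaler_suml.
  by apply: eq_bigr => i _; rewrite mxE scalerA.
move=> /b_ind xi0; case/negP: x0; apply/eqP/rowP => i.
by rewrite xi0 mxE.
Qed.

Lemma independent_extend d (b : 'I_d -> V) v : independent b ->
    ~ (exists c : 'I_d -> k, v = \sum_i c i *: b i) ->
  independent (fun i : 'I_d.+1 => oapp b v (unlift ord0 i)).
Proof.
move=> b_ind v_out c; rewrite big_ord_recl unlift_none /=.
under eq_bigr => i _ do rewrite liftK /=.
have [c0|c0] := eqVneq (c ord0) 0.
  rewrite c0 scale0r add0r => /b_ind cb i.
  by case: (unliftP ord0 i) => [j ->|-> //]; apply: cb.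
move=> /eqP; rewrite addr_eq0 => /eqP vE; case: v_out.
exists (fun i => - (c ord0)^-1 * c (lift ord0 i)).
apply: (scalerI c0); rewrite vE scaler_sumr -sumrN; apply: eq_bigr => i _.
by rewrite scalerA mulrA mulrN mulfV // mulN1r scaleNr.
Qed.

(** Independent families in [W] have at most as many members as the spanning
family; one of maximal size is a basis. *)
Lemma spanned_basis W : subspace W -> spanned W ->
  exists d (b : 'I_d -> V), is_basis W b.
Proof.
move=> [W0 WD] [N [e eW]].
pose P d := `[< exists b : 'I_d -> V, (forall i, W (b i)) /\ independent b >].
have exP : exists d, P d.
  by exists 0; apply/asboolP; exists (fun=> 0); split=> [|c _] [].
have leP d : P d -> (d <= N)%N.
  move=> /asboolP[b [Wb b_ind]]; apply: independent_leq b_ind => i.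
  exact/eW.
case: (ex_maxnP exP leP) => d /asboolP[b [Wb b_ind]] d_max.
exists d, b; split=> // v Wv; apply: contrapT => v_out.
suff /d_max : P d.+1 by rewrite ltnn.
apply/asboolP; exists (fun i => oapp b v (unlift ord0 i)); split.
  by move=> i; case: unlift.
exact: independent_extend.
Qed.

(** Two bases of [W] have the same size, each being independent in the span of
the other. *)
Lemma dimensionE W d (b : 'I_d -> V) : is_basis W b -> dimension W = d.
Proof.
move=> [Wb b_ind bW]; apply: xget_unique => [|d' [b' [Wb' b'_ind b'W]]].
  by exists b.
apply/eqP; rewrite eqn_leq; apply/andP; split.
  by apply: independent_leq b'_ind => i; apply: bW.
by apply: independent_leq b_ind => i; apply: b'W.
Qed.

End Subspaces.

Section RankNullity.
Variables (k : fieldType) (V V' : lmodType k) (f : {linear V -> V'}).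

Lemma spanned_image (W : set V) : spanned W -> spanned (f @` W).
Proof.
move=> [N [e eW]]; exists N, (f \o e) => _ [v /eW[c ->] <-]; exists c.
by rewrite linear_sum; apply: eq_bigr => i _; rewrite linearZ.
Qed.

Lemma subspace_image (W : set V) : subspace W -> subspace (f @` W).
Proof.
move=> [W0 WD]; split; first by exists 0; rewrite ?linear0.
move=> c _ _ [x Wx <-] [y Wy <-]; exists (c *: x + y); last exact: linearP.
exact: WD.
Qed.

(** A basis of the kernel together with lifts of a basis of the image is a basis. *)
Lemma dimension_rank_nullity (W : set V) : subspace W -> spanned W ->
  dimension W = addn (dimension (W `&` [set v | f v = 0])) (dimension (f @` W)).
Proof.
move=> sW fW.
have sK : subspace (W `&` [set v | f v = 0]).
  apply: subspaceI => //; split; first exact: linear0.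
  by move=> c x y /= fx fy; rewrite linearP fx fy scaler0 addr0.
have [d1 [b1 B1]] := spanned_basis sK (spanned_sub (@subIsetl _ _ _) fW).
have [d2 [b2 B2]] := spanned_basis (subspace_image sW) (spanned_image fW).
rewrite (dimensionE B1) (dimensionE B2).
case: B1 B2 => [Kb1 b1_ind b1K] [fWb2 b2_ind b2W].
have [w fw] := boolp.choice (fun i => (let: ex_intro2 x Wx fx := fWb2 i in
   ex_intro _ x (conj Wx fx)) : exists x, W x /\ f x = b2 i).
pose b (i : 'I_(d1 + d2)) := match fintype.split i with inl j => b1 j | inr j => w j end.
have bl j : b (lshift d2 j) = b1 j by rewrite /b (fintype.unsplitK (inl j)).
have br j : b (rshift d1 j) = w j by rewrite /b (fintype.unsplitK (inr j)).
have sumE (c : 'I_(d1 + d2) -> k) : \sum_i c i *: b i =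
    \sum_i c (lshift d2 i) *: b1 i + \sum_i c (rshift d1 i) *: w i.
  by rewrite big_split_ord /=; congr (_ + _); apply: eq_bigr => i _; rewrite ?bl ?br.
have fb1 (c : 'I_d1 -> k) : f (\sum_i c i *: b1 i) = 0.
  rewrite linear_sum big1 // => i _.
  by have [_ /= fb1] := Kb1 i; rewrite linearZ_LR fb1 scaler0.
have fwE (c : 'I_d2 -> k) : f (\sum_i c i *: w i) = \sum_i c i *: b2 i.
  by rewrite linear_sum; apply: eq_bigr => i _; rewrite linearZ_LR (fw i).2.
apply: (dimensionE (b := b)); split.
- by move=> i; rewrite /b; case: (fintype.split _) => j; [have [] := Kb1 j|have [] := fw j].
- move=> c; rewrite sumE => c0.
  have c2 : forall i, c (rshift d1 i) = 0.
    apply: b2_ind; rewrite -fwE -[LHS]add0r -(fb1 (fun i => c (lshift d2 i))).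
    by rewrite -raddfD c0 raddf0.
  move: c0; rewrite [X in _ + X]big1 => [|i _]; last by rewrite c2 scale0r.
  rewrite addr0 => /b1_ind c1 i.
  by rewrite -(fintype.splitK i); case: (fintype.split _) => j /=.
- move=> v Wv.
  have [|c2 fvE] := b2W (f v); first by exists v.
  have [|c1 vE] := b1K (v - \sum_i c2 i *: w i).
    split; last by rewrite /= linearB /= fwE -fvE subrr.
    case: (sW) => W0 WD; rewrite addrC -scaleN1r; apply: WD => //.
    by apply: subspace_lincomb => // i; case: (fw i).
  exists (fun i => match fintype.split i with inl j => c1 j | inr j => c2 j end).
  rewrite sumE -[LHS](subrK (\sum_i c2 i *: w i)) vE.
  congr (_ + _); apply: eq_bigr => i _.
    by rewrite (fintype.unsplitK (inl i)).
  by rewrite (fintype.unsplitK (inr i)).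
Qed.

End RankNullity.

(** * Homogeneous components *)

Section Degrees.
Variables (k : fieldType) (n : nat).
Local Notation A := {mpoly k[n.+1]}.
Implicit Types (f g p q : A) (I J : set A).

Definition x0deg (m : 'X_{1..n.+1}) : nat := m ord0.

Lemma x0degE m : x0deg m = m ord0. Proof. by []. Qed.

Lemma x0deg0 : x0deg 0%MM = 0%N. Proof. exact: mnm0E. Qed.

Lemma x0degD : {morph x0deg : m1 m2 / (m1 + m2)%MM >-> (m1 + m2)%N}.
Proof. by move=> m1 m2; apply: mnmDE. Qed.

HB.instance Definition _ := isMeasure.Build n.+1 x0deg x0deg0 x0degD.

Lemma mcoeff_pihomog (mf : measure n.+1) d p m :
  (pihomog mf d p)@_m = if mf m == d then p@_m else 0.
Proof.
rewrite pihomogE raddf_sum /= big_mkcond /=.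
transitivity (\sum_(m' <- msupp p)
    if m' == m then if mf m == d then p@_m else 0 else 0).
  apply: eq_bigr => m' _; rewrite mcoeffZ mcoeffX.
  by have [->|_] := eqVneq m' m; rewrite ?mulr1 ?mulr0 ?if_same.
rewrite -big_mkcond /=; have [m_p|m_p] := boolP (m \in msupp p).
  by rewrite -big_filter filter_pred1_uniq ?msupp_uniq // big_seq1.
by rewrite (memN_msupp_eq0 m_p) if_same big1.
Qed.

Lemma pihomog_comm (mf mf' : measure n.+1) d d' p :
  pihomog mf d (pihomog mf' d' p) = pihomog mf' d' (pihomog mf d p).
Proof. by apply/mpolyP => m; rewrite !mcoeff_pihomog; do 2 case: eqP. Qed.

Lemma mmeasure_leP (mf : measure n.+1) u p :
  reflect (forall m, m \in msupp p -> (mf m < u)%N) (mmeasure mf p <= u)%N.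
Proof.
apply: (iffP idP) => [pu m m_p|pu].
  exact: leq_trans (mmeasure_mnm_lt mf m_p) pu.
by rewrite mmeasureE big_seq; apply/bigmax_leqP_seq => m m_p _; apply: pu.
Qed.

Lemma mmeasure_sub_le (mf : measure n.+1) u p q : (mmeasure mf p <= u)%N ->
  (mmeasure mf q <= u)%N -> (mmeasure mf (p - q) <= u)%N.
Proof.
move=> pu qu; apply: leq_trans (mmeasureD_le _ _ _) _.
by rewrite mmeasureN geq_max pu qu.
Qed.

Lemma mmeasure_lincomb_le (mf : measure n.+1) u c p q : (mmeasure mf p <= u)%N ->
  (mmeasure mf q <= u)%N -> (mmeasure mf (c *: p + q) <= u)%N.
Proof.
move=> pu qu; apply: leq_trans (mmeasureD_le _ _ _) _.
by rewrite geq_max qu (leq_trans (mmeasureZ_le _ _ _)).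
Qed.

Lemma mmeasureM_le (mf : measure n.+1) u v p q : (mmeasure mf p <= u)%N ->
  (mmeasure mf q <= v.+1)%N -> (mmeasure mf (p * q) <= u + v)%N.
Proof.
move=> /mmeasure_leP pu /mmeasure_leP qv; apply/mmeasure_leP => m.
move=> /msuppM_le/allpairsP[[m1 m2] /= [/pu m1u /qv m2v ->]].
by rewrite mfD -addSn leq_add.
Qed.

Lemma mmeasure_pihomog_le (mf : measure n.+1) u p :
  (mmeasure mf (pihomog mf u p) <= u.+1)%N.
Proof. by apply/mmeasure_leP => m /(dhomogP _ _ _ (pihomogP mf u p)) ->. Qed.

(** The kernel of the top-degree component is the previous step of the filtration
by degree; all dimension counts for leading forms rest on this. *)
Lemma mmeasure_pihomog0 (mf : measure n.+1) u p : (mmeasure mf p <= u.+1)%N ->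
  (pihomog mf u p = 0) <-> (mmeasure mf p <= u)%N.
Proof.
move=> pu; split=> [pu0|/mmeasure_leP pu'].
  apply/mmeasure_leP => m m_p; have := mmeasure_leP _ _ _ pu m m_p.
  rewrite ltnS leq_eqVlt => /orP[/eqP mu|//].
  have := congr1 (mcoeff m) pu0; rewrite mcoeff_pihomog mu eqxx mcoeff0.
  by move/eqP; rewrite mcoeff_eq0 m_p.
apply/mpolyP => m; rewrite mcoeff_pihomog mcoeff0.
case: eqP => // mu; apply/eqP; rewrite mcoeff_eq0.
by apply/negP => /pu'; rewrite mu ltnn.
Qed.

Lemma mmeasure_pihomog_mono (mf mf' : measure n.+1) d p :
  (mmeasure mf (pihomog mf' d p) <= mmeasure mf p)%N.
Proof.
apply/mmeasure_leP => m; rewrite mcoeff_msupp mcoeff_pihomog.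
by case: ifP => [_|_ /eqP//]; rewrite -mcoeff_msupp; apply: mmeasure_mnm_lt.
Qed.

Lemma pihomog_std d f : std_grading d f -> pihomog mdeg d f = f.
Proof. exact: pihomog_dE. Qed.

Lemma std_grading_pihomog (mf : measure n.+1) u d f :
  std_grading d f -> std_grading d (pihomog mf u f).
Proof.
by move=> fd; rewrite -(pihomog_std fd) pihomog_comm; apply: pihomogP.
Qed.

(** For ideals, closure under taking components is what homogeneity amounts to.
This form applies at once to the standard degree and to the degree in the first
variable; an ideal closed for both is homogeneous for the bigrading. *)
Definition graded (mf : measure n.+1) I : Prop :=
  forall d f, I f -> I (pihomog mf d f).

Lemma ideal_sum I (T : Type) (s : seq T) (F : T -> A) : is_ideal I ->
  (forall t, I (F t)) -> I (\sum_(t <- s) F t).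
Proof. by move=> [I0 ID _] IF; elim/big_rec: _ => // t x _; apply: ID. Qed.

(** The components of the grading [G] may be finer than those of [mf], as for the
bigrading, whose parts are homogeneous both for the total degree and for the degree
in the first variable. *)
Lemma homogeneous_graded (mf : measure n.+1) (D : Type) (G : D -> set A)
    (e : D -> nat) I :
  (forall d g, G d g -> g \is [in k[n.+1], (e d).-homog for mf]) ->
  is_ideal I -> homogeneous G I -> graded mf I.
Proof.
move=> Ge I_ideal IG u f /IG[s [g [Ig ->]]].
rewrite (linear_sum (pihomog mf u)) /=; apply: ideal_sum => // d.
have [Igd /Ge gd] := Ig d; have [<-|eu] := eqVneq (e d) u.
  by rewrite pihomog_dE.
by rewrite (pihomog_ne0 eu gd); case: I_ideal.
Qed.

Lemma ideal_subspace I : is_ideal I -> subspace I.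
Proof.
move=> [I0 ID IM]; split=> // c x y Ix Iy.
by apply: ID => //; rewrite -mul_mpolyC; apply: IM.
Qed.

Lemma idealr_ideal (a : idealr A) : is_ideal [set` a].
Proof.
split=> [|f g|r f] /=; [exact: rpred0|exact: rpredD|exact: idealMr].
Qed.

Lemma std_grading_subspace d : subspace (std_grading d : set A).
Proof.
by split=> [|c x y] /=; [apply: dhomog0|move=> xd yd; apply: dhomogD => //; exact: dhomogZ].
Qed.

Lemma std_grading_spanned d : spanned (std_grading d : set A).
Proof.
pose T := 'X_{1..n.+1 < d.+1}.
exists #|{: T}|, (fun i => 'X_[(enum_val i : T)]) => f fd.
exists (fun i => f@_(enum_val i : T)).
rewrite -(big_enum_val (fun m : T => f@_m *: 'X_[m])) /= -mpolywE //.
by apply/mmeasure_leP => m m_f; rewrite (dhomogP _ _ _ fd).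
Qed.

End Degrees.
Arguments x0deg {n} m.

(** * Leading forms in the first variable *)

Section Initial.
Variables (k : fieldType) (n : nat).
Local Notation A := {mpoly k[n.+1]}.
Implicit Types (f g p q : A) (I J W : set A).
Local Notation xsize p := (mmeasure x0deg p).
Local Notation xpart := (pihomog x0deg).

(** The ideal of x_0-leading forms.  Instead of taking the span of leading forms,
one asks that every x_0-component of [f] is the leading form of an element
of [J], or zero.  The bound on the degree of [g], together with the component of
degree [u] being allowed to vanish, makes this a linear condition on [f]. *)
Definition initial J : set A :=
  [set f | forall u, exists g, [/\ J g, (xsize g <= u.+1)%N & xpart u g = xpart u f]].

Lemma initial_mono I J : I `<=` J -> initial I `<=` initial J.
Proof. by move=> IJ f If u; have [g [/IJ Jg gu gf]] := If u; exists g. Qed.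

(** Each component of [f] lies in [I] and is its own leading form. *)
Lemma sub_initial I : graded x0deg I -> I `<=` initial I.
Proof.
move=> xI f If u; exists (xpart u f); split; first exact: xI.
  exact: mmeasure_pihomog_le.
exact: pihomog_id.
Qed.

Lemma xpartMX m u f :
  xpart u ('X_[m] * f) = if (m ord0 <= u)%N then 'X_[m] * xpart (u - m ord0) f else 0.
Proof.
apply/mpolyP => m'; rewrite mcoeff_pihomog.
have [le_mm'|nle_mm'] := boolP (m <= m')%MM; last first.
  have X0 p : ('X_[m] * p)@_m' = 0.
    apply/eqP; rewrite mcoeff_eq0; apply: contra nle_mm'.
    move=> /msuppM_le/allpairsP[[m1 m2] /= [+ _ ->]].
    by rewrite msuppX inE => /eqP ->; apply: lem_addr.
  by case: ifP; case: ifP => _; rewrite ?X0 ?mcoeff0.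
rewrite -(submK le_mm') addmC; set m2 := (m' - m)%MM.
rewrite mulrC mcoeffMX mfD /= /x0deg.
case: (leqP (m ord0) u) => [mu|um]; last first.
  by rewrite mcoeff0; case: eqP => // E; rewrite -E ltnNge leq_addr in um.
rewrite ['X_[m] * _]mulrC mcoeffMX mcoeff_pihomog /x0deg.
by rewrite -[in RHS](eqn_add2l (m ord0)) subnKC.
Qed.

Lemma initial_ideal J : is_ideal J -> is_ideal (initial J).
Proof.
move=> J_ideal; have [J0 JD JM] := J_ideal.
have [_ JZ] := ideal_subspace J_ideal.
have I0 : initial J 0.
  by move=> u; exists 0; split=> //; rewrite mmeasure0.
have IZ c f g : initial J f -> initial J g -> initial J (c *: f + g).
  move=> If Ig u; have [f' [Jf fu ff]] := If u; have [g' [Jg gu gg]] := Ig u.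
  exists (c *: f' + g'); split; first exact: JZ.
    exact: mmeasure_lincomb_le.
  by rewrite !(linearP (pihomog x0deg u)) /= ff gg.
split=> // [f g If Ig|r f If].
  by rewrite -[f]scale1r; apply: IZ.
rewrite (mpolyE r) mulr_suml; elim/big_rec: _ => // m x _ Ix.
rewrite -scalerAl; apply: IZ => // u; rewrite xpartMX; case: ifP => mu; last first.
  by exists 0; split; rewrite ?mmeasure0 // pihomog0.
have [g [Jg gu gf]] := If (u - m ord0)%N.
exists ('X_[m] * g); split; [exact: JM| |by rewrite xpartMX mu gf].
apply: leq_trans (mmeasureM_le (u := (m ord0).+1) _ gu) _; first by rewrite mmeasureX.
by rewrite addSn subnKC.
Qed.

Lemma initial_graded J : graded mdeg J -> graded mdeg (initial J).
Proof.
move=> JG d f If u; have [g [Jg gu gf]] := If u.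
exists (pihomog mdeg d g); split; first exact: JG; last first.
  by rewrite pihomog_comm gf pihomog_comm.
exact: leq_trans (mmeasure_pihomog_mono _ _ _ _) gu.
Qed.

(** A component of [f] has only one nonzero component, for which the witness for
[f] serves again. *)
Lemma initial_xgraded J : J 0 -> graded x0deg (initial J).
Proof.
move=> J0 v f If u; have [->|uv] := eqVneq u v.
  by have [g [Jg gu gf]] := If v; exists g; rewrite pihomog_id.
exists 0; split; rewrite ?mmeasure0 // pihomog0.
by rewrite (pihomog_ne0 _ (pihomogP _ v f)) // eq_sym.
Qed.

(** Filter both spaces by the degree in x_0.  By rank-nullity the dimension grows at
step u by the dimension of the space of components of degree u, and these
components are the same for [J] and for [initial J], by definition of the
latter. *)
Lemma dimension_initial J d : is_ideal J -> graded mdeg J ->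
  dimension (initial J `&` std_grading d) = dimension (J `&` std_grading d).
Proof.
move=> J_ideal JG.
pose low u : set A := [set f | (xsize f <= u)%N].
have low_subspace u : subspace (low u).
  by split=> [|c x y]; [rewrite /low /= mmeasure0|apply: mmeasure_lincomb_le].
have sub I : is_ideal I -> subspace (I `&` std_grading d).
  by move=> /ideal_subspace sI; apply: subspaceI => //; apply: std_grading_subspace.
have fin W : spanned ((W `&` std_grading d) : set A).
  exact: spanned_sub (@subIsetr _ _ _) (std_grading_spanned _ _ _).
pose piece u W := (W `&` std_grading d) `&` low u.
have step u W : is_ideal W -> dimension (piece u.+1 W) =
    addn (dimension (piece u W)) (dimension (xpart u @` piece u.+1 W)).
  move=> W_ideal; rewrite (dimension_rank_nullity (pihomog x0deg u)).
  - congr (addn (dimension _) _); apply/seteqP; split=> f /=.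
      by move=> [[Wf fu] f0]; split=> //; apply/(mmeasure_pihomog0 fu).
    move=> [Wf fu]; have fu1 : (xsize f <= u.+1)%N by apply: leq_trans fu _.
    by split; first split; last exact/(mmeasure_pihomog0 fu1).
  - exact/subspaceI/low_subspace/sub.
  - exact: spanned_sub (@subIsetl _ _ _) (fin W).
(* Elements of degree d have x_0-degree at most d, so the filtration is exhausted. *)
have top W : W `&` std_grading d = piece d.+1 W.
  apply/seteqP; split=> f [] // Wf fd; split=> //.
  apply/mmeasure_leP => m m_f; rewrite -(dhomogP _ _ _ fd m m_f) ltnS.
  by rewrite /= x0degE mdegE (bigD1 ord0) //= leq_addr.
have same u : xpart u @` piece u.+1 (initial J) = xpart u @` piece u.+1 J.
  apply/seteqP; split=> _ [f [[If fd] fu] <-]; last first.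
    exists (xpart u f); last exact: pihomog_id.
    split; last exact: mmeasure_pihomog_le.
    split; last exact: std_grading_pihomog.
    move=> v; have [->|uv] := eqVneq v u; first by exists f; rewrite pihomog_id.
    exists 0; split; rewrite ?mmeasure0 // ?pihomog0; first by case: J_ideal.
    by rewrite (pihomog_ne0 _ (pihomogP _ u f)) // eq_sym.
  have [g [Jg gu gf]] := If u.
  exists (pihomog mdeg d g); last by rewrite pihomog_comm gf -pihomog_comm pihomog_std.
  split; first by split; [exact: JG|exact: pihomogP].
  exact: leq_trans (mmeasure_pihomog_mono _ _ _ _) gu.
(* At the bottom of the filtration both spaces are zero. *)
rewrite !top; elim: d.+1 => [|u IH]; last first.
  by rewrite !step ?same ?IH //; apply: initial_ideal.
congr dimension; apply/seteqP; split=> f [[_ fd] f0]; (split; last exact: f0);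
  split=> //; move: f0; rewrite /low /= leqn0 mmeasure_poly_eq0 => /eqP ->.
  by case: J_ideal.
by case: (initial_ideal J_ideal).
Qed.

End Initial.

(** * Distractions and leading forms *)

Section Distraction.
Variables (k : fieldType) (n : nat).
Local Notation A := {mpoly k[n.+1]}.
Implicit Types (f g p q : A) (I J : set A).
Local Notation xsize p := (mmeasure x0deg p).
Local Notation xpart := (pihomog x0deg).

Variable L : 'I_n.+1 -> nat -> A.
Hypothesis L_distr : distraction_matrix L.
Hypothesis L_var : forall i : 'I_n.+1, i != ord0 -> forall j, L i j = 'X_i.
Local Notation D := (distraction L).

Lemma distractionX_homog m : D 'X_[m] \is (mdeg m).-homog.
Proof.
have [L1 _ _] := L_distr; rewrite distractionX mdegE.
elim/big_rec2: _ => [|i p d _ IH]; first exact: dhomog1.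
apply: dhomogM => //; elim: (m i) => [|e IHe].
  by rewrite big_geq //; apply: dhomog1.
by rewrite big_nat_recr //= -[X in X.-homog]addn1; apply: dhomogM IHe (L1 i e.+1).
Qed.

Lemma distraction_pihomog d f :
  D (pihomog mdeg d f) = pihomog mdeg d (D f).
Proof.
rewrite (mpolyE f) (linear_sum (pihomog mdeg d)) !(linear_sum D) (linear_sum (pihomog mdeg d)).
apply: eq_bigr => m _; rewrite /= !linearZ_LR /=; congr (_ *: _).
have Dm := distractionX_homog m; rewrite pihomogX; have [<-|md] := eqVneq (mdeg m) d.
  by rewrite pihomog_dE.
by rewrite (pihomog_ne0 md Dm) linear0.
Qed.

(** The coefficient of a monomial of x_0-degree [u] in its own distraction. *)
Definition xlead u : k := \prod_(1 <= j < u.+1) (L ord0 j)@_(U_(ord0)).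

Lemma xleadS u : xlead u.+1 = xlead u * (L ord0 u.+1)@_(U_(ord0)).
Proof. by rewrite /xlead big_nat_recr. Qed.

(** The form in the first row and column j must span the linear forms together with
x_1, ..., x_n, so it involves x_0. *)
Lemma xlead_neq0 u : xlead u != 0.
Proof.
rewrite /xlead prodf_seq_neq0; apply/allP => j _; apply/implyP => _.
have [_ /(_ (fun=> j) 'X_ord0) span _] := L_distr.
have [|c] := span; first by rewrite /std_grading /= dhomogX /= mdeg1.
move=> /(congr1 (mcoeff U_(ord0))); rewrite mcoeffX eqxx raddf_sum /=.
rewrite (bigD1 ord0) //= big1 ?addr0 => [|i i0]; last first.
  by rewrite mcoeffZ L_var // mcoeffX eq_mnm1 (negPf i0) mulr0.
rewrite mcoeffZ; apply: contra_eq_neq => ->.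
by rewrite mulr0 oner_eq0.
Qed.

Lemma xsize_linear_form j :
  (xsize (L ord0 j - (L ord0 j)@_(U_(ord0)) *: 'X_ord0) <= 1)%N.
Proof.
have [L1 _ _] := L_distr; set l := L _ _; set q := l - _.
have q1 : std_grading 1 q.
  rewrite /std_grading /= rpredB ?rpredZ //=; first exact: L1.
  by rewrite dhomogX /= mdeg1.
apply/mmeasure_leP => m m_q; rewrite ltnS leqn0; apply: contraT => m0.
have /eqP := dhomogP _ _ _ q1 m m_q; rewrite /= mdeg_eq1 => /existsP[i /eqP mE].
have i0 : i = ord0.
  by apply/eqP; move: m0; rewrite mE /= x0degE mnm1E eqb0 negbK.
move: m_q; rewrite mcoeff_msupp mE i0 mcoeffB mcoeffZ mcoeffX eqxx mulr1.
by rewrite subrr eqxx.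
Qed.

(** Each form is c x_0 plus terms free of x_0, so the product of e of them is the
product of the c's times x_0^e, up to terms of lower x_0-degree. *)
Lemma xsize_prod_forms e : (xsize (\prod_(1 <= j < e.+1) L ord0 j
  - xlead e *: 'X_ord0 ^+ e) <= e)%N.
Proof.
elim: e => [|e IH].
  by rewrite /xlead !big_geq // scale1r subrr mmeasure0.
rewrite exprSr xleadS big_nat_recr //=.
set P := (\prod_(_ <= j < _) _ : A) in IH *; set X := 'X_ord0 ^+ e : A.
set l := L ord0 e.+1; set c := l@__.
have -> : P * l - (xlead e * c) *: (X * 'X_ord0) =
    (P - xlead e *: X) * l - (- xlead e) *: (X * (l - c *: 'X_ord0)).
  rewrite mulrBl mulrBr !scaleNr opprK scalerBr -scalerAl -scalerAr scalerA.
  by rewrite addrA subrK.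
have lX : (xsize (l - c *: 'X_ord0) <= 1)%N by apply: xsize_linear_form.
apply: mmeasure_sub_le; last first.
  apply: leq_trans (mmeasureZ_le _ _ _) _; rewrite -[e.+1]addn0.
  apply: mmeasureM_le => //; rewrite /X mpolyXn mmeasureX ltnS.
  by rewrite /= x0degE mulmnE mnm1E eqxx mul1n.
rewrite -[leqRHS]addn1; apply: mmeasureM_le => //.
rewrite -(subrK (c *: 'X_ord0) l) addrC; apply: mmeasure_lincomb_le.
  by rewrite mmeasureX /= x0degE mnm1E eqxx.
exact: leq_trans lX _.
Qed.

(** The rows of [L] other than the first contribute the same factor to the
distraction of a monomial and to the monomial, a factor free of x_0. *)
Lemma xsize_distractionX m :
  (xsize (D 'X_[m] - xlead (m ord0) *: 'X_[m]) <= m ord0)%N.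
Proof.
rewrite distractionX mpolyXE_id (bigD1 ord0) //= [in X in _ - X](bigD1 ord0) //=.
set Q := (\prod_(_ | _) 'X_ _ ^+ _ : A).
rewrite (_ : (\prod_(_ | _) \prod_(_ <= _ < _) _) = Q); last first.
  apply: eq_bigr => i i0; under eq_bigr => j _ do rewrite L_var //.
  by rewrite prodr_const_nat subSS subn0.
rewrite scalerAl -mulrBl -[leqRHS]addn0; apply: mmeasureM_le.
  exact: xsize_prod_forms.
rewrite /Q; elim/big_rec: _ => [|i p i0 IH]; first by rewrite mmeasure1.
rewrite -[1%N]addn0; apply: mmeasureM_le => //.
rewrite mpolyXn mmeasureX ltnS leqn0 /= x0degE mulmnE mnm1E.
by rewrite (negPf i0).
Qed.

Lemma xsize_distraction u f : (xsize f <= u.+1)%N ->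
  (xsize (D f - xlead u *: xpart u f) <= u)%N.
Proof.
move=> /mmeasure_leP fu.
rewrite [in D _](mpolyE f) [X in xpart u X](mpolyE f).
rewrite (linear_sum D) (linear_sum (pihomog x0deg u)) scaler_sumr -sumrB.
rewrite big_seq; elim/big_rec: _ => [|m p /fu m_u IH]; first by rewrite mmeasure0.
have scaleCA (c : k) (g : A) : xlead u *: (c *: g) = c *: (xlead u *: g).
  by rewrite !scalerA mulrC.
rewrite (linearZ_LR D) (linearZ_LR (pihomog x0deg u)) /= scaleCA -scalerBr.
apply: mmeasure_lincomb_le => //; rewrite pihomogX.
have Dm := xsize_distractionX m.
move: m_u; rewrite ltnS /= leq_eqVlt => /orP[/eqP mu|mu].
  by rewrite mu eqxx -mu.
rewrite (ltn_eqF mu) scaler0 subr0 -(subrK (xlead (m ord0) *: 'X_[m]) (D _)) addrC.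
apply: mmeasure_lincomb_le; first by rewrite mmeasureX.
exact: leq_trans Dm (ltnW mu).
Qed.

Lemma xsize_distraction_le u f : (xsize f <= u.+1)%N -> (xsize (D f) <= u.+1)%N.
Proof.
move=> fu; rewrite -(subrK (xlead u *: xpart u f) (D f)) addrC.
apply: mmeasure_lincomb_le; first exact: mmeasure_pihomog_le.
by rewrite ltnW // ltnS xsize_distraction.
Qed.

Lemma xpart_distraction u f : (xsize f <= u.+1)%N ->
  xpart u (D f) = xlead u *: xpart u f.
Proof.
move=> fu; have Df := xsize_distraction fu.
have /(mmeasure_pihomog0 (leq_trans Df (leqnSn u))) := Df.
rewrite linearB linearZ_LR /= pihomog_id => /eqP.
by rewrite subr_eq0 => /eqP.
Qed.

(** The leading form of [distraction L f] is a nonzero multiple of that of [f], so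
[f] descends through the whole filtration by x_0-degree. *)
Lemma distraction_eq0 f : D f = 0 -> f = 0.
Proof.
move=> Df; apply/eqP; rewrite -(mmeasure_poly_eq0 x0deg) -leqn0.
have : (xsize f <= xsize f)%N by [].
elim: {2}(xsize f) => [//|u IH fu]; apply: IH; apply/(mmeasure_pihomog0 fu).
apply: (scalerI (xlead_neq0 u)).
by rewrite -xpart_distraction // Df scaler0 pihomog0.
Qed.

(** Every x_0-component of an element of [I] is, up to a nonzero scalar, the
leading form of its distraction, which lies in [J]. *)
Lemma sub_initial_distraction I J : graded x0deg I -> is_ideal J ->
  D @` I `<=` J -> I `<=` initial J.
Proof.
move=> xI /ideal_subspace[J0 JZ] DI f If u.
have fu := mmeasure_pihomog_le x0deg u f.
exists ((xlead u)^-1 *: D (xpart u f)); split.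
- rewrite -[_ *: _]addr0; apply: JZ => //; apply: DI.
  by exists (xpart u f) => //; apply: xI.
- exact: leq_trans (mmeasureZ_le _ _ _) (xsize_distraction_le fu).
- rewrite linearZ_LR /= xpart_distraction // pihomog_id scalerA mulVf ?scale1r //.
  exact: xlead_neq0.
Qed.

Lemma distraction_graded I : graded mdeg I -> graded mdeg (D @` I).
Proof.
move=> IG d _ [f If <-]; exists (pihomog mdeg d f); first exact: IG.
exact: distraction_pihomog.
Qed.

(** Multiplication by x_i with i > 0 commutes with the distraction.  For x_0 one
works on each x_0-component of degree e separately, where multiplication by
x_0 corresponds to multiplication by the form in column e + 1; that form and
the other variables span x_0.  The ideal [I] may be the whole ring, as happens for
the leading forms of the unit ideal. *)
Lemma is_ideal_distraction I : is_ideal I -> graded x0deg I -> is_ideal (D @` I).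
Proof.
move=> I_ideal xI; have [I0 ID IM] := I_ideal.
have [DI0 DIZ] := subspace_image (distraction L) (ideal_subspace I_ideal).
have DID f g : (D @` I) f -> (D @` I) g -> (D @` I) (f + g).
  by move=> If Ig; rewrite -[f]scale1r; apply: DIZ.
have DIX i p : (D @` I) p -> (D @` I) ('X_i * p).
  move=> [f If <-].
  have [->{i}|i0] := eqVneq i ord0; last first.
    by exists ('X_i * f); rewrite ?distractionM_var //; apply: IM.
  rewrite [f](pihomog_partitionE (leqnn (xsize f))) linear_sum mulr_sumr /=.
  elim/big_rec: _ => // e p' _; apply: DID.
  have [_ /(_ (fun=> e.+1) 'X_ord0) span _] := L_distr.
  have [|c ->] := span; first by rewrite /std_grading /= dhomogX /= mdeg1.
  rewrite mulr_suml; elim/big_rec: _ => // j q _ Iq.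
  rewrite -scalerAl; apply: DIZ => //.
  exists ('X_j * xpart e f); first exact/IM/xI.
  have [->|j0] := eqVneq j ord0; last by rewrite /= distractionM_var // L_var.
  apply: distractionM_hom => m; exact: (dhomogP _ _ _ (pihomogP x0deg e f)).
split=> // r p Ip.
rewrite (mpolyE r) mulr_suml; elim/big_rec: _ => // m q _ Iq.
rewrite -scalerAl; apply: DIZ => // {q Iq}.
rewrite mpolyXE_id; elim/big_rec: _ => [|i x _ IH]; first by rewrite mul1r.
rewrite -mulrA; elim: (m i) => [|e IHe]; first by rewrite mul1r.
by rewrite exprS -mulrA; apply: DIX.
Qed.

Lemma dimension_distraction I d : is_ideal I -> graded mdeg I ->
  dimension (D @` I `&` std_grading d) = dimension (I `&` std_grading d).
Proof.
move=> I_ideal IG.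
have -> : D @` I `&` std_grading d = D @` (I `&` std_grading d).
  apply/seteqP; split=> [_ [[f If <-] Dfd]|_ [f [If fd] <-]].
    exists (pihomog mdeg d f); last by rewrite distraction_pihomog pihomog_dE.
    by split; [exact: IG|exact: pihomogP].
  split; first by exists f.
  by rewrite /std_grading /= homog_piE -distraction_pihomog pihomog_dE.
have sI : subspace (I `&` std_grading d).
  by apply: subspaceI; [exact: ideal_subspace|exact: std_grading_subspace].
rewrite [RHS](dimension_rank_nullity (distraction L) sI); last first.
  exact: spanned_sub (@subIsetr _ _ _) (std_grading_spanned _ _ _).
have ker0 : is_basis (I `&` std_grading d `&` [set v | D v = 0]) (fun _ : 'I_0 => 0).
  split=> [[]//|c _ []//|v [_ /= Dv]].
  by exists (fun=> 0); rewrite big_ord0; apply: distraction_eq0.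
by rewrite (dimensionE ker0) add0n.
Qed.

End Distraction.

(** * Ideals of a quotient and their Hilbert functions *)

Section Quotient.
Variables (k : fieldType) (n : nat).
Local Notation A := {mpoly k[n.+1]}.
Variables (B : comAlgType k) (q : {linear A -> B}).
Hypothesis qM : {morph q : f g / f * g}.
Hypothesis q_surj : forall x, exists f, q f = x.
Local Notation K := [set f | q f = 0].
Local Notation G := (fun d => q @` std_grading d).
Implicit Types (f g : A) (I : set A) (J : set B).

Lemma preimage_ideal J : is_ideal J -> is_ideal (q @^-1` J).
Proof.
move=> [J0 JD JM]; split=> [|f g Jf Jg|r f Jf] /=; rewrite ?linear0 //.
  by rewrite linearD; apply: JD.
by rewrite qM; apply: JM.
Qed.

Lemma ker_sub_preimage J : is_ideal J -> K `<=` q @^-1` J.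
Proof. by move=> [J0 _ _] f /= ->. Qed.

(** Lift the components of the image of [f]: the sum of the lifts differs from [f] by
an element of the kernel, which is itself graded. *)
Lemma preimage_graded J : graded mdeg K -> is_ideal J ->
  homogeneous G J -> graded mdeg (q @^-1` J).
Proof.
move=> KG J_ideal JG d f /JG[s [g [Jg fE]]].
have lift e : exists x : A, std_grading e x /\ q x = g e.
  by have [_ [x xe gx]] := Jg e; exists x.
have [h hP] := boolp.choice lift.
have P_ideal := preimage_ideal J_ideal.
pose r := f - \sum_(e <- s) h e.
have rK : K r.
  rewrite /= linearB fE linear_sum -sumrB big1 // => e _.
  by have [_ ->] := hP e; rewrite subrr.
rewrite -(subrK (\sum_(e <- s) h e) f) -/r linearD.
have [_ PD _] := P_ideal; apply: PD.
  by apply: ker_sub_preimage => //; apply: KG.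
rewrite linear_sum; apply: ideal_sum => // e.
have [he hg] := hP e; have [<-|ed] := eqVneq e d.
  by rewrite /= pihomog_std // hg; case: (Jg e).
by rewrite /= (pihomog_ne0 ed he); case: P_ideal.
Qed.

Lemma image_homogeneous_ideal I : is_ideal I -> graded mdeg I ->
  homogeneous_ideals G (q @` I).
Proof.
move=> [I0 ID IM] IG; split.
  split=> [|_ _ [f If <-] [g Ig <-]|r _ [f If <-]].
  - by exists 0; rewrite ?linear0.
  - by exists (f + g); [apply: ID|rewrite linearD].
  - by have [g <-] := q_surj r; exists (g * f); [apply: IM|rewrite qM].
move=> _ [f If <-].
exists (index_iota 0 (msize f)), (fun d => q (pihomog mdeg d f)); split.
  move=> d; split; first by exists (pihomog mdeg d f) => //; apply: IG.
  by exists (pihomog mdeg d f) => //; apply: pihomogP.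
by rewrite {1}(pihomog_partitionE (leqnn (msize f))) linear_sum big_mkord.
Qed.

(** Rank-nullity in each degree. *)
Lemma hilbert_series_image I d : is_ideal I -> K `<=` I ->
  hilbert_series G (q @` I) d =
    (dimension (I `&` std_grading d))%:Z - (dimension (K `&` std_grading d))%:Z.
Proof.
move=> I_ideal KI; rewrite /hilbert_series.
have -> : q @` I `&` q @` std_grading d = q @` (I `&` std_grading d).
  apply/seteqP; split=> [_ [[f If <-] [g gd gf]]|_ [f [If fd] <-]]; last first.
    by split; exists f.
  (* The homogeneous lift g differs from f by an element of K, hence lies in I. *)
  exists g => //; split=> //; rewrite -(subrK f g).
  have [_ ID _] := I_ideal; apply: ID => //; apply: KI => /=.
  by rewrite linearB gf subrr.
rewrite (dimension_rank_nullity q (W := I `&` std_grading d)); first last.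
- exact: spanned_sub (@subIsetr _ _ _) (std_grading_spanned _ _ _).
- by apply: subspaceI; [exact: ideal_subspace|exact: std_grading_subspace].
have -> : I `&` std_grading d `&` K = K `&` std_grading d.
  apply/seteqP; split=> f [].
    by move=> [_ fd].
  by move=> fK fd; split; [split=> //; apply: KI|].
by rewrite PoszD addrAC subrr add0r.
Qed.

Lemma image_preimage_surj J : q @` (q @^-1` J) = J.
Proof.
apply/seteqP; split=> [_ [f Jf <-] //|x Jx].
by have [f fx] := q_surj x; exists f => //=; rewrite fx.
Qed.

End Quotient.

(** * Transfer of embeddings *)

Section Transfer.
Variables (k : fieldType) (n : nat).
Local Notation A := {mpoly k[n.+1]}.
Variable L : 'I_n.+1 -> nat -> A.
Hypothesis L_distr : distraction_matrix L.
Hypothesis L_var : forall i : 'I_n.+1, i != ord0 -> forall j, L i j = 'X_i.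
Variables (R R' : comAlgType k) (q : {linear A -> R}) (q' : {linear A -> R'}).
Hypotheses (qM : {morph q : f g / f * g}) (qM' : {morph q' : f g / f * g}).
Hypotheses (q_surj : forall x, exists f, q f = x).
Hypotheses (q_surj' : forall x, exists f, q' f = x).
Local Notation a := [set f | q f = 0].
Local Notation b := [set f | q' f = 0].
Local Notation G := (fun d => q @` std_grading d).
Local Notation G' := (fun d => q' @` std_grading d).
Hypotheses (a_ideal : is_ideal a) (a_graded : graded mdeg a) (a_xgraded : graded x0deg a).
Hypothesis bE : b = distraction L @` a.

Let bG : graded mdeg b.
Proof. by rewrite bE; apply: distraction_graded. Qed.

Let bD d : dimension (b `&` std_grading d) = dimension (a `&` std_grading d).
Proof. by rewrite bE dimension_distraction. Qed.

(** For an ideal of R' with preimage P, the ideal of leading forms of P contains the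
kernel a of q, because P contains the distraction b of a; its image in R
therefore has the same Hilbert function as the given ideal. *)
Lemma hilbert_set_sub : hilbert_set G' `<=` hilbert_set G.
Proof.
move=> _ [J [J_ideal JG] <-]; set P := q' @^-1` J.
have P_ideal : is_ideal P by apply: preimage_ideal.
have PG : graded mdeg P by apply: preimage_graded.
have aP : a `<=` initial P.
  apply: (sub_initial_distraction L_distr L_var) => //.
  by rewrite -bE; apply: ker_sub_preimage.
have I_ideal := initial_ideal P_ideal.
exists (q @` initial P).
  by apply: image_homogeneous_ideal => //; apply: initial_graded.
apply/funext => d; rewrite hilbert_series_image //.
rewrite -[in RHS](image_preimage_surj q_surj' J) hilbert_series_image //.
  by rewrite dimension_initial // bD.
exact: ker_sub_preimage.
Qed.

(** Leading forms are taken first to make the ideal bihomogeneous, without which its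
distraction need not be an ideal. *)
Definition transfer (E : set R) : set R' :=
  q' @` (distraction L @` initial (q @^-1` E)).

Lemma transfer_mono E F : E `<=` F -> transfer E `<=` transfer F.
Proof.
by move=> EF; do 2 apply: image_subset; apply: initial_mono => f; apply: EF.
Qed.

(** Leading forms and distraction both preserve dimensions in A, and the kernels a and
b have the same Hilbert function, so nothing changes in the quotients. *)
Lemma transferP E : homogeneous_ideals G E ->
  homogeneous_ideals G' (transfer E) /\
  hilbert_series G' (transfer E) = hilbert_series G E.
Proof.
move=> [E_ideal EG]; rewrite /transfer; set P := q @^-1` E.
have P_ideal : is_ideal P by apply: preimage_ideal.
have PG : graded mdeg P by apply: preimage_graded.
have aP : a `<=` P by apply: ker_sub_preimage.
have I_ideal := initial_ideal P_ideal; have IG := initial_graded PG.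
have IX : graded x0deg (initial P) by apply: initial_xgraded; case: P_ideal.
have D_ideal : is_ideal (distraction L @` initial P) by apply: is_ideal_distraction.
have bDI : b `<=` distraction L @` initial P.
  rewrite bE; apply: image_subset; apply: subset_trans (initial_mono aP).
  exact: sub_initial.
split; first by apply: image_homogeneous_ideal => //; apply: distraction_graded.
apply/funext => d; rewrite hilbert_series_image // bD dimension_distraction //.
rewrite dimension_initial // -[in RHS](image_preimage_surj q_surj E).
by rewrite hilbert_series_image.
Qed.

Lemma admits_embedding_distraction : admits_embedding G -> admits_embedding G'.
Proof.
move=> [eps [eps_fun _ eps_mono eps_hilb]].
have hilb H : hilbert_set G' H -> hilbert_series G' (transfer (eps H)) = H.
  by move=> /hilbert_set_sub GH; rewrite (transferP (eps_fun _ GH)).2 eps_hilb.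
exists (transfer \o eps); split=> //=.
- by move=> H /hilbert_set_sub/eps_fun/transferP[].
- by move=> H H' HH HH' E; rewrite -(hilb _ HH) E hilb.
- move=> H H' /hilbert_set_sub GH /hilbert_set_sub GH' leH.
  exact/transfer_mono/eps_mono.
Qed.

End Transfer.

Section QuotientMap.
Variables (k : fieldType) (A : comAlgType k) (b : idealr A).
Local Notation Q := {ideal_quot b}.

Definition quot_map (f : A) : Q := (\pi_Q f)%qT.

Lemma quot_map_linear : linear quot_map.
Proof. move=> c f g; rewrite /quot_map -pi_quotZ; exact: rmorphD. Qed.

HB.instance Definition _ := GRing.isLinear.Build k A Q *:%R quot_map quot_map_linear.

Lemma quot_mapM : {morph quot_map : f g / f * g}.
Proof. exact: rmorphM. Qed.

Lemma quot_map_surj (x : Q) : exists f, quot_map f = x.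
Proof. by exists (repr x); apply: reprK. Qed.

Lemma quot_map_ker : [set f | quot_map f = 0] = [set` b].
Proof.
have E f : (f \in (b : pred A)) = (quot_map f == quot_map 0).
  by rewrite -[f in LHS]subr0 Quotient.idealrBE.
apply/seteqP; split=> f /=; rewrite ?E linear0; first by move=> ->.
by move/eqP.
Qed.

End QuotientMap.

Theorem proposition3p17 (k : fieldType) (k_infinite : infinite_set [set: k])
    (n : nat) (a : idealr {mpoly k[n.+1]})
    (a_bigraded : homogeneous bigrading [set` a])
    (a_1 : [set` a] `&` std_grading 1 = [set 0])
    (L : 'I_n.+1 -> nat -> {mpoly k[n.+1]})
    (L_distr : distraction_matrix L)
    (L_var : forall i : 'I_n.+1, i != ord0 -> forall j, L i j = 'X_i) :
  admits_embedding (quot_grading a) ->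
  admits_embedding (quot_grading (distraction_ideal L_distr L_var a_bigraded)).
Proof.
set b := distraction_ideal _ _ _.
have a_ideal := idealr_ideal a.
apply: (admits_embedding_distraction L_distr L_var
  (@quot_mapM _ _ a) (@quot_mapM _ _ b) (@quot_map_surj _ _ a) (@quot_map_surj _ _ b)).
- by rewrite quot_map_ker.
- rewrite quot_map_ker.
  apply: (homogeneous_graded (e := fun uv => (uv.1 + uv.2)%N) _ _ a_bigraded) => //.
  move=> [u v] g gu /=; apply/dhomogP => m /gu [<- <-].
  by rewrite /= mdegE (bigD1 ord0).
- rewrite quot_map_ker.
  apply: (homogeneous_graded (e := fst) _ _ a_bigraded) => // -[u v] g gu /=.
  by apply/dhomogP => m /gu []; rewrite /= x0degE.
- rewrite !quot_map_ker.
  by apply/seteqP; split=> f; [move=> /asboolP|move=> Df; apply/asboolP].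
Qed.
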